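(* For every $d\in\mathbb{N}$ there exists a constant $C(d)>0$ such that for every $n\in\mathbb{N}$, every nonempty $Q\subset\mathbb{Z}^d\cap[-2^n,2^n]^d$ and every $k\in\mathbb{N}$, $$\varepsilon_k(\mathcal{T}(Q)_1,L_\infty)\le C(d)\begin{cases}n^{3/2}\,(|Q|/k),&k\le2|Q|,\\ n^{3/2}\,2^{-k/(2|Q|)},&k\ge2|Q|.\end{cases}$$
   Context: $\mathbb{T}^d=[0,2\pi)^d$ is the torus with normalized Lebesgue measure $(2\pi)^{-d}d\mathbf{x}$; $\|\cdot\|_1$ is the corresponding $L_1$ norm and $L_\infty$ carries the uniform norm. $\mathbb{N}=\{1,2,\dots\}$. For finite $Q\subset\mathbb{Z}^d$, $\mathcal{T}(Q)$ is the complex linear space of trigonometric polynomials $\sum_{\mathbf{k}\in Q}c_{\mathbf{k}}e^{i(\mathbf{k},\mathbf{x})}$, and $\mathcal{T}(Q)_1:=\{f\in\mathcal{T}(Q):\|f\|_1\le1\}$. For a compact subset $A$ of a Banach space $X$, the entropy numbers are $$\varepsilon_k(A,X):=\inf\{\varepsilon:\exists\,y^1,\dots,y^{2^k}\in A:\ A\subseteq\textstyle\bigcup_{j=1}^{2^k}B_X(y^j,\varepsilon)\},$$ where $B_X(y,\varepsilon)=\{x\in X:\|x-y\|\le\varepsilon\}$. *)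

(* Defs.v *)
From HB Require Import structures.
From mathcomp Require Import all_boot all_order all_algebra.
From mathcomp Require Import finmap complex.
From mathcomp Require Import all_classical all_reals all_analysis.

Set Implicit Arguments.
Unset Strict Implicit.
Unset Printing Implicit Defensive.

Import Order.TTheory GRing.Theory Num.Theory.
Import ComplexField.

Local Open Scope classical_set_scope.
Local Open Scope ring_scope.

(* R^d is the type of d-tuples. The library gives it the product sigma-algebra
   but no measure, so Lebesgue measure is defined by induction on d, as the
   image of a product measure under (x, v) |-> x :: v. *)
Definition tcons (T : Type) (d : nat) (p : T * d.-tuple T) : d.+1.-tuple T :=
  [tuple of p.1 :: p.2].

Fixpoint lebesgue_tuple (R : realType) (d : nat) :
    set (d.-tuple (measurableTypeR R)) -> \bar R :=
  match d with
  | 0%N => dirac [tuple]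
  | d'.+1 =>
      pushforward (@lebesgue_measure R \x @lebesgue_tuple R d')%E
        (@tcons (measurableTypeR R) d')
  end.

Arguments lebesgue_tuple : clear implicits.

Section lebesgue_tuple_measure.
Context (R : realType).
Local Notation mR := (measurableTypeR R).

Lemma measurable_tcons (d : nat) :
  measurable_fun [set: mR * d.-tuple mR] (@tcons mR d).
Proof. exact: measurable_cons. Qed.

Lemma sigma_finite_tcons (d : nat)
    (m : {sigma_finite_measure set (d.-tuple mR) -> \bar R}) :
  sigma_finite [set: d.+1.-tuple mR]
    (pushforward (@lebesgue_measure R \x m)%E (@tcons mR d)).
Proof.
have /sigma_finiteP[F [TF ndF Foo]] := sigma_finiteT (@lebesgue_measure R).
have /sigma_finiteP[G [TG ndG Goo]] := sigma_finiteT m.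
pose g (v : d.+1.-tuple mR) : mR * d.-tuple mR := (thead v, [tuple of behead v]).
have mg : measurable_fun [set: d.+1.-tuple mR] g.
  apply/measurable_fun_pairP; split; last exact: measurable_behead.
  exact: measurable_tnth.
have gK : g \o @tcons mR d = id.
  apply/funext => -[x v]; rewrite /g /tcons /= theadE; congr pair.
  exact: val_inj.
exists (fun i => g @^-1` (F i `*` G i)).
  apply/seteqP; split => // v _.
  have [i _ Fi] : (\bigcup_i F i) (g v).1 by rewrite -TF.
  have [j _ Gj] : (\bigcup_i G i) (g v).2 by rewrite -TG.
  exists (maxn i j) => //; split.
    by move: Fi; exact/subsetPset/ndF/leq_maxl.
  by move: Gj; exact/subsetPset/ndG/leq_maxr.
move=> i; have [mFi Fi] := Foo i; have [mGi Gi] := Goo i; split.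
  by rewrite -[X in measurable X]setTI; apply: mg => //; exact: measurableX.
rewrite /pushforward -comp_preimage gK preimage_id product_measure1E//.
by rewrite lte_mul_pinfty// ge0_fin_numE.
Qed.

Lemma lebesgue_tuple_sigma_finite (d : nat) :
  exists m : {sigma_finite_measure set (d.-tuple mR) -> \bar R},
    lebesgue_tuple R d = m :> (set _ -> \bar R).
Proof.
elim: d => [|d [m mE]] /=; first by eexists.
rewrite mE; pose p := pushforward (@lebesgue_measure R \x m)%E (@tcons mR d).
have p0 : p set0 = 0%E by apply: measure0; exact: measurable_tcons.
have p_ge0 A : (0 <= p A)%E by apply: measure_ge0; exact: measurable_tcons.
have p_sigma : semi_sigma_additive p.
  by apply: measure_semi_sigma_additive; exact: measurable_tcons.
have p_sf : sigma_finite setT p by exact: sigma_finite_tcons.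
rewrite -/p; clearbody p.
pose hm := isMeasure.Build _ _ _ p p0 p_ge0 p_sigma.
pose p1 : {measure set (d.+1.-tuple mR) -> \bar R} := HB.pack p hm.
pose hs := Measure_isSigmaFinite.Build _ _ _ p1 p_sf.
pose p2 : {sigma_finite_measure set _ -> \bar R} := HB.pack p hm hs.
by exists p2.
Qed.

Context (d : nat).
Local Notation mu := (lebesgue_tuple R d).

Let mu0 : mu set0 = 0%E.
Proof. by have [m ->] := lebesgue_tuple_sigma_finite d. Qed.

Let mu_ge0 A : (0 <= mu A)%E.
Proof. by have [m ->] := lebesgue_tuple_sigma_finite d. Qed.

Let mu_sigma_additive : semi_sigma_additive mu.
Proof.
have [m ->] := lebesgue_tuple_sigma_finite d.
exact: measure_semi_sigma_additive.
Qed.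

HB.instance Definition _ := isMeasure.Build _ _ _ mu mu0 mu_ge0
  mu_sigma_additive.

Let mu_sigma_finite : sigma_finite setT mu.
Proof.
by have [m ->] := lebesgue_tuple_sigma_finite d; exact: sigma_finiteT.
Qed.

HB.instance Definition _ := Measure_isSigmaFinite.Build _ _ _ mu
  mu_sigma_finite.

End lebesgue_tuple_measure.

Definition torus (R : realType) (d : nat) : set (d.-tuple R) :=
  [set x | forall i, 0 <= tnth x i < 2 * pi].
Arguments torus : clear implicits.

Definition L1norm (R : realType) (d : nat) (f : d.-tuple R -> R[i]) : \bar R :=
  (((2 * pi) ^- d)%:E *
   \int[lebesgue_tuple R d]_(x in torus R d) (Normc.normc (f x))%:E)%E.

(* Only the values on the torus count; +oo if f is unbounded there. *)
Definition sup_norm (R : realType) (d : nat) (f : d.-tuple R -> R[i]) :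
    \bar R :=
  ereal_sup [set (Normc.normc (f x))%:E | x in torus R d].

Definition expi (R : realType) (t : R) : R[i] := (cos t +i* sin t)%C.

Definition dotzr (R : realType) (d : nat) (k : d.-tuple int) (x : d.-tuple R) :
    R :=
  \sum_(i < d) (tnth k i)%:~R * tnth x i.

(* The polynomials are 2pi-periodic functions on R^d. *)
Definition trig_poly (R : realType) (d : nat) (Q : {fset d.-tuple int}) :
    set (d.-tuple R -> R[i]) :=
  [set f | exists c : d.-tuple int -> R[i],
    f = fun x => \sum_(k <- Q) c k * expi (dotzr k x)].

Arguments trig_poly R {d} Q.

Definition trig_poly_ball (R : realType) (d : nat) (Q : {fset d.-tuple int}) :
    set (d.-tuple R -> R[i]) :=
  [set f | trig_poly R Q f /\ (L1norm f <= 1)%E].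
Arguments trig_poly_ball R {d} Q.

(* N is the norm of the ambient space. It may take the value +oo, so that the
   space of all functions with the uniform norm can stand for L_oo: every ball
   around a bounded function contains bounded functions only. *)
Section entropy.
Context (R : realType) (X : zmodType) (N : X -> \bar R).

Definition norm_cball (y : X) (e : R) : set X :=
  [set x | (N (x - y)%R <= e%:E)%E].

(* The infimum is taken in the extended reals: it is +oo, and not 0, when no
   radius is admissible. *)
Definition entropy_number (k : nat) (A : set X) : \bar R :=
  ereal_inf [set e%:E | e in
    [set e : R | exists y : 'I_(2 ^ k) -> X,
      (forall j, A (y j)) /\ A `<=` \bigcup_j norm_cball (y j) e]].

End entropy.

(* Main.v *)
Require Import Defs.
From HB Require Import structures.
From mathcomp Require Import all_boot all_order all_algebra.
From mathcomp Require Import finmap complex.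
From mathcomp Require Import all_classical all_reals all_analysis.
From mathcomp Require Import measurable_realfun.
From mathcomp Require Import ring lra zify.

Import Order.TTheory GRing.Theory Num.Theory.
Local Open Scope ring_scope.

(* Let m = 2|Q| be the real dimension of T(Q). On T(Q) the uniform norm is
   comparable with a maximum of |G| linear functionals whose coefficients are
   bounded by 1, where log |G| = O(n): evaluation at the nodes of a fine grid,
   and the coordinates themselves. A perceptron argument covers the Euclidean
   ball of radius rho by (2|G| + 1)^T balls of radius e in this maximum norm as
   soon as T e^2 >= m rho^2. If the L_1 ball is covered by balls of radius r,
   then ||f||_2^2 <= ||f||_1 ||f||_oo bounds the Euclidean norm within each of
   them by O(sqrt r), so that the greedy covering can be applied again; doubling
   the number of bits thereby halves the radius, and after k bits the radius is
   O(n m / k). Beyond k = m one concludes with the bound (1 + 2/delta)^m for the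
   covering numbers of a ball, which is obtained without volumes, by nesting a
   packing into itself and comparing powers with a crude bound. This gives the
   factor n, which is at most n^(3/2). *)

(** * Coverings in a norm given by a dictionary *)

Section Dictionary.
Local Open Scope classical_set_scope.
Context (R : realType) (J G : finType) (a : G -> J -> R).
Context (a_le1 : forall g j, `|a g j| <= 1).
Context (J_gt0 : (0 < #|J|)%N).
Implicit Types (x y z u : J -> R) (e t : R) (A : set (J -> R)).

Definition dot u x : R := \sum_j u j * x j.

Lemma dotC u x : dot u x = dot x u.
Proof. by apply: eq_bigr => j _; rewrite mulrC. Qed.

Lemma dotDr u x y : dot u (x + y) = dot u x + dot u y.
Proof. by rewrite -big_split; apply: eq_bigr => j _ /=; rewrite -mulrDr. Qed.

Lemma dotNr u x : dot u (- x) = - dot u x.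
Proof. by rewrite -sumrN; apply: eq_bigr => j _ /=; rewrite -mulrN. Qed.

Lemma dotBr u x y : dot u (x - y) = dot u x - dot u y.
Proof. by rewrite dotDr dotNr. Qed.

Lemma dotZr u t x : dot u (t \*o x) = t * dot u x.
Proof. by rewrite mulr_sumr; apply: eq_bigr => j _ /=; rewrite mulrCA. Qed.

Lemma dotBl u x y : dot (x - y) u = dot x u - dot y u.
Proof. by rewrite dotC dotBr !(dotC u). Qed.

Lemma dotZl u t x : dot (t \*o x) u = t * dot x u.
Proof. by rewrite dotC dotZr dotC. Qed.

(* The norm max_g |<a_g, x>| enters only through its sublevel sets. *)
Definition nrm_le x e := forall g, `|dot (a g) x| <= e.

Lemma nrm_leD x y e e' : nrm_le x e -> nrm_le y e' -> nrm_le (x + y) (e + e').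
Proof.
by move=> xe ye g; rewrite dotDr (le_trans (ler_normD _ _))// lerD.
Qed.

Lemma nrm_leN x e : nrm_le x e -> nrm_le (- x) e.
Proof. by move=> xe g; rewrite dotNr normrN. Qed.

Lemma nrm_leB x y e e' : nrm_le x e -> nrm_le y e' -> nrm_le (x - y) (e + e').
Proof. by move=> xe /nrm_leN; exact: nrm_leD. Qed.

Lemma nrm_leBC x y e : nrm_le (x - y) e -> nrm_le (y - x) e.
Proof. by move/nrm_leN; rewrite opprB. Qed.

Lemma nrm_leBD x y z e e' :
  nrm_le (x - y) e -> nrm_le (y - z) e' -> nrm_le (x - z) (e + e').
Proof. by move=> xy yz; have := nrm_leD _ _ _ _ xy yz; rewrite subrKA. Qed.

Lemma nrm_le_weak x e e' : e <= e' -> nrm_le x e -> nrm_le x e'.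
Proof. by move=> ee xe g; exact: le_trans (xe g) ee. Qed.

Lemma nrm_leZ x e t : 0 < t -> nrm_le (t \*o x) (t * e) <-> nrm_le x e.
Proof.
by move=> t0; split=> xe g; have := xe g;
  rewrite dotZr normrM (gtr0_norm t0) ler_pM2l.
Qed.

Lemma nrm_le_max x e :
  (forall j, `|x j| <= e) -> nrm_le x (#|J|%:R * e).
Proof.
move=> xe g; rewrite (le_trans (ler_norm_sum _ _ _))//.
rewrite mulr_natl -sumr_const ler_sum// => j _.
by rewrite normrM -[leRHS]mul1r ler_pM.
Qed.

(** The boolean is the sign of the move; [None] is an idle move, which pads greedy runs that stop
    early to a fixed length. *)
Definition atom e (o : option (G * bool)) : J -> R :=
  if o is Some (g, s) then (e / #|J|%:R * (-1) ^+ s) \*o a g else 0.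

(* As long as some <a_g, x> exceeds e, subtracting a multiple of a_g decreases
   the squared Euclidean norm by at least e^2/#|J|. *)
Lemma greedy (T : nat) e x : 0 < e -> dot x x * #|J|%:R <= T%:R * e ^+ 2 ->
  exists s : T.-tuple (option (G * bool)),
    nrm_le (x - \sum_(o <- s) atom e o) e.
Proof.
move=> e0; have m0 : 0 < #|J|%:R :> R by rewrite ltr0n.
elim: T x => [|T IH] x xT.
  (* With no move allowed, the hypothesis forces [x = 0]. *)
  exists [tuple] => g; rewrite big_nil subr0.
  have x0 j : x j = 0.
    apply/eqP; rewrite -sqrf_eq0; apply/eqP/le_anti; rewrite sqr_ge0 andbT.
    have : dot x x <= 0 by move: xT; rewrite mul0r pmulr_lle0.
    apply: le_trans; rewrite /dot (bigD1 j)//= -expr2 lerDl.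
    by apply: sumr_ge0 => i _; rewrite -expr2 sqr_ge0.
  by rewrite /dot big1 ?normr0 ?ltW// => j _; rewrite x0 mulr0.
have [xe|/existsNP[g /negP]] := pselect (nrm_le x e).
  exists [tuple of nseq T.+1 None]; rewrite big1_seq ?subr0// => o.
  by rewrite mem_nseq => /andP[_ /eqP ->].
rewrite -ltNge => ge; pose s := dot (a g) x < 0.
have [|s' s'P] := IH (x - atom e (Some (g, s))); last first.
  exists [tuple of Some (g, s) :: s'].
  by rewrite big_cons opprD addrA.
have aa : dot (a g) (a g) <= #|J|%:R.
  rewrite -[leRHS]mulr1 mulr_natl -sumr_const ler_sum// => j _.
  by rewrite (le_trans (ler_norm _))// normrM mulr_ile1.
have sd : (-1) ^+ s * dot (a g) x = `|dot (a g) x|.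
  by rewrite -normrEsign.
rewrite /= dotBl !dotBr !dotZl !dotZr (dotC x) -!mulrA sd.
rewrite [X in _ - (_ - X)](_ : _ =
  (e / #|J|%:R) ^+ 2 * dot (a g) (a g)); last first.
  have : ((-1) ^+ s) ^+ 2 = 1 :> R by rewrite sqrr_sign.
  by set u := (-1) ^+ s => u2; rewrite -[RHS]mul1r -u2; ring.
set d := `|_| in ge *; set D := dot (a g) (a g) in aa *.
set N : R := #|J|%:R in m0 aa xT *.
(* Since [d] exceeds [e] and [D] is at most [N], this is at most [dot x x * N - e ^+ 2], which pays
   for one move. *)
have -> : (dot x x - e * (N^-1 * d) - (e * (N^-1 * d) - (e / N) ^+ 2 * D)) * N
  = dot x x * N - 2 * (e * d) + e ^+ 2 * (D / N) by field; rewrite gt_eqF.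
have : e ^+ 2 * (D / N) <= e ^+ 2.
  by rewrite ler_piMr ?sqr_ge0// ler_pdivrMr ?mul1r.
have : e * e <= e * d by rewrite ler_pM2l// ltW.
move: xT; rewrite -natr1 mulrDl mul1r.
set E := _ * (D / N); set F := e * d; set H := T%:R * _; set K := _ * N.
by rewrite expr2; lra.
Qed.

Definition covers A (c : nat) e :=
  exists y : 'I_c -> J -> R, forall x, A x -> exists i, nrm_le (x - y i) e.

(** Entropy numbers ask for centres in the set itself; greedy sums provide only free centres, whence
    the two notions. *)
Definition covers_in A (c : nat) e :=
  exists y : 'I_c -> J -> R, (forall i, A (y i)) /\
    forall x, A x -> exists i, nrm_le (x - y i) e.

Lemma covers_fin (T : finType) (y : T -> J -> R) A (c : nat) e :
  (#|T| <= c)%N -> (forall x, A x -> exists i, nrm_le (x - y i) e) ->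
  covers A c e.
Proof.
move=> Tc Ay.
exists (fun i =>
  if insub (val i) is Some i' then y (@enum_val T T i') else 0) => x.
move=> /Ay[t xt]; exists (widen_ord Tc (enum_rank t)).
by rewrite /= valK enum_rankK.
Qed.

(** Each centre is replaced by a point of [A] in its ball, at the cost of a second radius; balls
    that miss [A] receive the dummy centre [x0]. *)
Lemma covers_recenter A c e : A !=set0 -> covers A c e ->
  covers_in A c (2 * e).
Proof.
move=> [x0 Ax0] [y Ay].
pose B i : set (J -> R) := fun x => A x /\ nrm_le (x - y i) e.
exists (fun i => if pselect (B i !=set0) is left b then projT1 (cid b) else x0).
split=> [i|x Ax]; first by case: pselect => // b; case: cid => z [].
have [i xi] := Ay x Ax; exists i; case: pselect => [b|[]]; last by exists x.
case: cid => z [_ /= /nrm_leBC zi]; rewrite mulr_natl mulr2n.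
exact: nrm_leBD xi zi.
Qed.

Lemma covers_comp A c e c' e' : covers_in A c e ->
  (forall z, A z -> covers (fun x => A x /\ nrm_le (x - z) e) c' e') ->
  covers A (c * c') e'.
Proof.
move=> [y [yA Ay]] H.
have [w wP] := choice (fun i => H (y i) (yA i)).
apply: (@covers_fin ('I_c * 'I_c')%type (fun p => w p.1 p.2)).
  by rewrite card_prod !card_ord.
move=> x Ax; have [i xi] := Ay x Ax.
by have [k xk] := wP i x (conj Ax xi); exists (i, k).
Qed.

Lemma covers_in_weak A c e c' e' : A !=set0 -> (c <= c')%N -> e <= e' ->
  covers_in A c e -> covers_in A c' e'.
Proof.
move=> [x0 Ax0] cc ee [y [yA Ay]].
exists (fun i => oapp y x0 (insub (val i))); split=> [i|x /Ay[i xi]].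
  by case: insubP => [u _ _|_]; [exact: yA|exact: Ax0].
by exists (widen_ord cc i); rewrite /= valK; exact: nrm_le_weak xi.
Qed.

Lemma covers_in_one A e : A !=set0 ->
  (forall x y, A x -> A y -> nrm_le (x - y) e) -> covers_in A 1 e.
Proof.
move=> [x0 Ax0] Ae; exists (fun=> x0); split=> // x Ax.
by exists ord0; exact: Ae.
Qed.

(** A run consists of [T] moves, each one of [2 * #|G|] signed atoms or the idle move. *)
Lemma covers_greedy A z (T : nat) e : 0 < e ->
  (forall x, A x -> dot (x - z) (x - z) * #|J|%:R <= T%:R * e ^+ 2) ->
  covers A ((2 * #|G|).+1 ^ T) e.
Proof.
move=> e0 AT.
apply: (@covers_fin (T.-tuple (option (G * bool)))
  (fun s => z + \sum_(o <- s) atom e o)).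
  by rewrite card_tuple card_option card_prod card_bool mulnC.
move=> x /AT /(greedy _ _ _ e0)[s xs]; exists s.
by rewrite opprD addrA.
Qed.

(* Doubling the number of points halves the radius: the differences of A that
   lie in a small ball have a small Euclidean norm, so the greedy step covers
   them at once. *)
Lemma covers_dyadic A (kappa : R) : 0 < kappa -> A !=set0 ->
  (forall x y t, A x -> A y -> nrm_le (x - y) t ->
     dot (x - y) (x - y) <= kappa * t) ->
  (forall x y, A x -> A y -> nrm_le (x - y) (16 * kappa * #|J|%:R)) ->
  forall i, covers_in A ((2 * #|G|).+1 ^ (2 ^ i))
    (16 * kappa * #|J|%:R / (2 ^ i)%:R).
Proof.
move=> k0 A0 Adot Adiam; have m0 : 0 < #|J|%:R :> R by rewrite ltr0n.
elim=> [|i IH].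
  rewrite divr1; apply: covers_in_weak (covers_in_one _ _ A0 Adiam) => //.
set r := _ / _ in IH; have p0 : 0 < (2 ^ i)%:R :> R by rewrite ltr0n expn_gt0.
have r0 : 0 < r by rewrite divr_gt0// !mulr_gt0.
(* The greedy step reaches radius [r / 4], and recentering doubles it to [r / 2]. *)
have -> : 16 * kappa * #|J|%:R / (2 ^ i.+1)%:R = 2 * (r / 4).
  by rewrite /r expnS natrM; field; rewrite gt_eqF.
apply: covers_recenter => //; rewrite expnSr muln2 -addnn expnD.
apply: covers_comp IH _ => z Az.
apply: covers_greedy => [|x [Ax xz]]; first by rewrite divr_gt0.
(* The constant 16 makes [kappa * r * #|J|] equal to [2 ^ i * (r / 4) ^ 2], so exactly [2 ^ i] moves
   suffice. *)
have : dot (x - z) (x - z) * #|J|%:R <= kappa * r * #|J|%:R.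
  by rewrite ler_wpM2r ?ler0n//; exact: Adot.
move=> /le_trans; apply; rewrite le_eqVlt; apply/orP; left; apply/eqP.
by rewrite /r; field; rewrite gt_eqF.
Qed.

(** * Packings and covering numbers of balls *)

Context (nrm_coord : forall x e, nrm_le x e -> forall j, `|x j| <= e).

(** In other words, [N] disjoint balls of radius [t] inside the unit ball; this form allows packings
    to be nested. *)
Definition packs (N : nat) t := exists y : 'I_N -> J -> R,
  (forall i, nrm_le (y i) (1 - t)) /\
  (forall i j, nrm_le (y i - y j) (2 * t) -> i = j).

(** A copy of the second packing, scaled by [t], is placed in every ball of the first. *)
Lemma packs_mul N t N' t' : 0 < t -> packs N t -> packs N' t' ->
  packs (N * N') (t * t').
Proof.
move=> t0 [y [y1 ysep]] [z [z1 zsep]].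
have cardE : #|{: 'I_N * 'I_N'}| = (N * N')%N by rewrite card_prod !card_ord.
pose f (i : 'I_(N * N')) : 'I_N * 'I_N' := enum_val (cast_ord (esym cardE) i).
have f_inj : injective f.
  by move=> i j /enum_val_inj /cast_ord_inj.
have tz k : nrm_le (t \*o z k) (t * (1 - t')) by apply/nrm_leZ.
exists (fun i => y (f i).1 + t \*o z (f i).2); split=> [i|i j].
  have -> : 1 - t * t' = (1 - t) + t * (1 - t') by ring.
  exact: nrm_leD.
move=> ij; apply: f_inj; move: ij; case: (f i) (f j) => [i1 i2] [j1 j2] /=.
rewrite opprD addrACA => ij.
(* The scaled points contribute at most [2 * t * (1 - t')], which together with [2 * t * t'] gives
   the separation [2 * t] of the first packing. *)
have e1 : i1 = j1.
  apply: ysep; have := nrm_leB _ _ _ _ ij (nrm_leB _ _ _ _ (tz i2) (tz j2)).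
  rewrite addrK; apply: nrm_le_weak; rewrite le_eqVlt; apply/orP; left.
  by apply/eqP; ring.
congr pair => //; apply: zsep; apply/(nrm_leZ _ _ _ t0).
move: ij; rewrite e1 subrr add0r mulrCA; congr nrm_le.
by apply/funext => k; rewrite !fctE /= mulrBr.
Qed.

Lemma packsX N t p : 0 < t -> packs N t -> packs (N ^ p) (t ^+ p).
Proof.
move=> t0 Nt; elim: p => [|p IH].
  exists (fun=> 0); split=> [i g|i j _]; last by rewrite !ord1.
  by rewrite subrr /dot big1 ?normr0// => k _; rewrite mulr0.
by rewrite expnS exprS; exact: packs_mul.
Qed.

(* The exponent is sharp but the constant depends on #|J|; it disappears by
   passing to powers of a packing. *)
Lemma packs_crude N t : 0 < t <= 1 -> packs N t ->
  N%:R <= ((#|J|.+1)%:R / t) ^+ #|J| :> R.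
Proof.
move=> /andP[t0 t1] [y [y1 ysep]]; have m0 : 0 < #|J|%:R :> R by rewrite ltr0n.
(* The side of the cells: [#|J| * h = 2 * t], so two points in one cell would violate the
   separation. *)
pose h := 2 * t / #|J|%:R.
have h0 : 0 < h by rewrite divr_gt0// mulr_gt0.
have yj i j : 0 <= y i j + 1 <= 2.
  have : `|y i j| <= 1.
    by apply: nrm_coord; apply: nrm_le_weak (y1 i); rewrite gerBl ltW.
  rewrite ler_norml => /andP[]; lra.
pose K := (Num.trunc (2 / h)).+1.
pose cell i : {ffun J -> 'I_K} :=
  [ffun j => inord (Num.trunc ((y i j + 1) / h))].
have cell_inj : injective cell.
  move=> i i' /ffunP ii; apply: ysep.
  have -> : 2 * t = #|J|%:R * h by rewrite /h; field; rewrite gt_eqF.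
  apply: nrm_le_max => j; have := ii j; rewrite !ffunE => /(congr1 val) /=.
  have cellK k : (Num.trunc ((y k j + 1) / h) < K)%N.
    by rewrite ltnS le_truncn// ler_pM2r ?invr_gt0//; have /andP[] := yj k j.
  rewrite !inordK//.
  have y0 k : 0 <= (y k j + 1) / h.
    by apply: divr_ge0; [have /andP[] := yj k j|exact: ltW].
  have /andP[a1 a2] := truncn_itv (y0 i').
  have /andP[b1 b2] := truncn_itv (y0 i) => ab.
  rewrite ab in b1 b2; set c := Num.trunc _ in a1 a2 b1 b2.
  have -> : (y i - y i') j = ((y i j + 1) / h - (y i' j + 1) / h) * h.
    by rewrite !fctE; field; rewrite gt_eqF.
  rewrite normrM (gtr0_norm h0) ler_piMl ?(ltW h0)// ler_norml.
  by move: a2 b2; rewrite -natr1; lra.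
have : (N <= K ^ #|J|)%N.
  rewrite -[N]card_ord (leq_trans (leq_card _ cell_inj))//.
  by rewrite card_ffun card_ord.
rewrite -(ler_nat R) natrX => /le_trans; apply.
rewrite lerXn2r ?nnegrE ?ler0n ?divr_ge0 ?ler0n ?(ltW t0)//.
rewrite /K; have : (Num.trunc (2 / h))%:R <= 2 / h.
  by rewrite truncn_le divr_ge0 ?(ltW h0).
have -> : 2 / h = #|J|%:R / t by rewrite /h; field; rewrite !gt_eqF.
move=> tr; rewrite -natr1 -[(#|J|.+1)%:R]natr1 mulrDl lerD// mul1r.
by rewrite invf_ge1.
Qed.

(** Applied to the [p]-th power of the packing, [packs_crude] bounds [q ^+ p] by [C] for every [p],
    which is impossible if [q] exceeds 1. *)
Lemma packs_bound N t : 0 < t <= 1 -> packs N t -> N%:R * t ^+ #|J| <= 1 :> R.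
Proof.
move=> t01; have /andP[t0 t1] := t01 => Nt.
set q := N%:R * _; rewrite leNgt; apply/negP => q1.
pose C : R := (#|J|.+1)%:R ^+ #|J|.
have qC p : q ^+ p <= C.
  have := packs_crude (N ^ p) (t ^+ p); rewrite exprn_gt0//=.
  rewrite exprn_ile1 ?(ltW t0)//.
  move=> /(_ isT (packsX _ _ _ t0 Nt)).
  rewrite expr_div_n ler_pdivlMr ?exprn_gt0// natrX.
  by rewrite /q exprMn -!exprM (mulnC p).
(* By Bernoulli's inequality, this exponent already carries [q ^+ p] beyond [C]. *)
have := qC (Num.trunc (C / (q - 1))).+1; apply/negP; rewrite -ltNge.
set p := _.+1; have qp : 1 + p%:R * (q - 1) <= q ^+ p.
  elim: {qC} p => [|p IH]; first by rewrite mul0r addr0 expr0.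
  rewrite exprS; have : q * (1 + p%:R * (q - 1)) <= q * q ^+ p.
    by rewrite ler_pM2l// (lt_trans _ q1).
  apply: le_trans; rewrite -natr1 -subr_ge0.
  have -> : q * (1 + p%:R * (q - 1)) - (1 + (p%:R + 1) * (q - 1)) =
    p%:R * (q - 1) ^+ 2 by ring.
  by rewrite mulr_ge0 ?sqr_ge0.
apply: lt_le_trans qp; have : C < p%:R * (q - 1).
  by rewrite -ltr_pdivrMr ?subr_gt0// truncnS_gt.
lra.
Qed.

(* A maximal separated subset of a ball is a net. *)
Lemma covers_ball z r delta (c : nat) : 0 < r -> 0 < delta ->
  (1 + 2 / delta) ^+ #|J| <= c%:R ->
  covers (fun x => nrm_le (x - z) r) c (delta * r).
Proof.
move=> r0 d0 cP; have r_neq0 : r != 0 by rewrite gt_eqF.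
pose sep N := exists y : 'I_N -> J -> R, (forall i, nrm_le (y i - z) r) /\
  (forall i j, nrm_le (y i - y j) (delta * r) -> i = j).
have sep_le N : sep N -> (N <= c)%N.
  move=> [y [yr ysep]]; rewrite -(ler_nat R); apply: le_trans cP.
  (* With this [t], scaling by [(1 - t) / r] turns radius [r] into [1 - t] and separation
     [delta * r] into [2 * t]. *)
  pose t := delta / (2 + delta).
  have d2 : 0 < 2 + delta by lra.
  have t0 : 0 < t by rewrite divr_gt0.
  have t1 : t <= 1 by rewrite ler_pdivrMr//; lra.
  have dE : 1 + 2 / delta = t^-1 by rewrite /t; field; rewrite !gt_eqF.
  rewrite dE exprVn -[leRHS]mul1r ler_pdivlMr ?exprn_gt0//.
  apply: packs_bound; first by rewrite t0.
  have s0 : 0 < (1 - t) / r.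
    by rewrite divr_gt0// /t subr_gt0 ltr_pdivrMr//; lra.
  exists (fun i => ((1 - t) / r) \*o (y i - z)); split=> [i|i j ij].
    by rewrite -[X in nrm_le _ X](divfK r_neq0); apply/nrm_leZ.
  apply: ysep; apply/(nrm_leZ _ _ _ s0).
  have -> : (1 - t) / r * (delta * r) = 2 * t.
    by rewrite /t; field; rewrite !gt_eqF.
  move: ij; congr nrm_le.
  by apply/funext => k; rewrite !fctE /= -mulrBr; congr (_ * _); ring.
have sep0 : exists N, `[< sep N >].
  by exists 0%N; apply/asboolP; exists (fun=> 0); split=> [] [].
have sep_ub N : `[< sep N >] -> (N <= c)%N by move=> /asboolP/sep_le.
case: (ex_maxnP sep0 sep_ub) => N /asboolP[y [yr ysep]] Nmax.
apply: (@covers_fin _ y); first by rewrite card_ord; apply: sep_le; exists y.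
move=> x xr; apply: contrapT => /forallNP xy.
(* A point far from all [y i] could be added to the family, against maximality. *)
suff /asboolP/Nmax : sep N.+1 by rewrite ltnn.
exists (fun i => oapp y x (unlift ord_max i)); split=> [i|i j].
  by case: unliftP => [i' _|_]; [exact: yr|exact: xr].
case: (unliftP ord_max i) => [i'|] ->;
  case: (unliftP ord_max j) => [j'|] -> //=.
- by move=> /ysep ->.
- by move=> /nrm_leBC /xy.
- by move=> /xy.
Qed.

(** * Coverings by [2 ^ k] points *)

Section Entropy.
Context (A : set (J -> R)) (kappa : R) (L : nat).
Context (kappa_gt0 : 0 < kappa).
Context (A_neq0 : A !=set0).
Context (A_dot : forall x y t, A x -> A y -> nrm_le (x - y) t ->
  dot (x - y) (x - y) <= kappa * t).
Context (A_diam : forall x y, A x -> A y ->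
  nrm_le (x - y) (16 * kappa * #|J|%:R)).
Context (L_gt0 : (0 < L)%N).
Context (G_le : ((2 * #|G|).+1 <= 2 ^ L)%N).

(** One greedy move costs at most [L] bits, so the dyadic level [i] costs at most [L * 2 ^ i]. The
    largest affordable level loses at most a factor 2 in the radius. *)
Lemma covers_small k : (0 < k)%N ->
  covers_in A (2 ^ k) (32 * kappa * L%:R * (#|J|%:R / k%:R)).
Proof.
move=> k0; have cov := covers_dyadic A kappa kappa_gt0 A_neq0 A_dot A_diam.
have m0 : 0 < #|J|%:R :> R by rewrite ltr0n.
pose i := trunc_log 2 (k %/ L).
have kR0 : 0 < k%:R :> R by rewrite ltr0n.
have kL : (k < L * 2 ^ i.+1)%N.
  by rewrite mulnC -ltn_divLR// trunc_log_ltn.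
have e_le : 16 * kappa * #|J|%:R / (2 ^ i)%:R <=
    32 * kappa * L%:R * (#|J|%:R / k%:R).
  rewrite ler_pdivrMr ?ltr0n ?expn_gt0//.
  have -> : 32 * kappa * L%:R * (#|J|%:R / k%:R) * (2 ^ i)%:R =
    16 * kappa * #|J|%:R * ((L * 2 ^ i.+1)%:R / k%:R).
    by rewrite expnS !natrM; field; rewrite gt_eqF.
  by rewrite ler_peMr ?mulr_ge0 ?(ltW m0) ?(ltW kappa_gt0)//
    ler_pdivlMr// mul1r ler_nat ltnW.
(* Fewer than [L] bits do not pay for a single move; then [i = 0] and one point suffices. *)
have [kL'|Lk] := ltnP k L.
  apply: covers_in_weak (covers_in_one _ _ A_neq0 A_diam) => //.
    by rewrite expn_gt0.
  by move: e_le; rewrite /i divn_small// divr1.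
apply: covers_in_weak e_le (cov i) => //.
apply: (@leq_trans ((2 ^ L) ^ (2 ^ i))); first by rewrite leq_exp2r ?expn_gt0.
by rewrite -expnM leq_exp2l// mulnC -leq_divRL// trunc_logP// divn_gt0.
Qed.

(** The first [#|J|] bits are spent on [covers_small], the others on covering each resulting ball by
    [covers_ball]. *)
Lemma covers_large k : (#|J| <= k)%N ->
  covers_in A (2 ^ k) (512 * kappa * L%:R * 2 `^ (- (k%:R / #|J|%:R))).
Proof.
move=> mk; have m0 : 0 < #|J|%:R :> R by rewrite ltr0n.
set m := #|J| in m0 mk *.
have cov : covers_in A (2 ^ m) (32 * kappa * L%:R).
  by have := covers_small m J_gt0; rewrite divff ?mulr1// gt_eqF.
set r := 32 * kappa * L%:R in cov.
have r0 : 0 < r by rewrite !mulr_gt0 ?ltr0n.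
have -> : 512 * kappa * L%:R = 16 * r by rewrite /r; ring.
set w := 2 `^ _; have w0 : 0 < w by rewrite powR_gt0.
have wE : w^-1 ^+ m = (2 ^ k)%:R.
  rewrite /w powRN invrK -powR_mulrn ?powR_ge0// -powRrM divfK ?gt_eqF//.
  by rewrite powR_mulrn// natrX.
(* Below [2 * m] bits, [w] is at least 1/4 and the first stage alone is good enough. *)
have [k2|k2] := ltnP k (m + m).
  apply: covers_in_weak cov => //; first by rewrite leq_exp2l.
  have : w^-1 <= 4.
    have -> : 4 = 2 `^ 2 :> R by rewrite powR_mulrn//; ring.
    rewrite /w powRN invrK ler_powR ?ler1n// ler_pdivrMr//.
    by rewrite mulr_natl mulr2n -natrD ler_nat ltnW.
  rewrite invf_ple ?posrE// => w4.
  by rewrite -mulrA (mulrC r) mulrA ler_peMl ?(ltW r0)//; lra.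
pose l := (k - m)%N.
have -> : 16 * r * w = 2 * ((8 * w) * r) by ring.
apply: covers_recenter => //.
have -> : (2 ^ k = 2 ^ m * 2 ^ l)%N by rewrite -expnD subnKC.
apply: covers_comp cov _ => z _.
suff [y yP] : covers (fun x => nrm_le (x - z) r) (2 ^ l) (8 * w * r).
  by exists y => x [_ /yP].
apply: covers_ball => //; first by rewrite mulr_gt0.
have w4 : 4 <= w^-1.
  have -> : 4 = 2 `^ 2 :> R by rewrite powR_mulrn//; ring.
  rewrite /w powRN invrK ler_powR ?ler1n// ler_pdivlMr//.
  by rewrite mulr_natl mulr2n -natrD ler_nat.
(* With [delta = 8 * w] the required bound reads [1 + w^-1 / 4 <= w^-1 / 2], which holds because
   [w^-1] is at least 4. *)
have -> : (2 ^ l)%:R = (w^-1 / 2) ^+ m.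
  rewrite exprMn wE exprVn -[in RHS](subnKC mk) expnD natrM -/l !natrX.
  by rewrite mulrAC divff ?mul1r// expf_neq0.
rewrite lerXn2r ?nnegrE//.
- by rewrite addr_ge0// divr_ge0// mulr_ge0// ltW.
- by rewrite divr_ge0// invr_ge0 ltW.
have -> : 2 / (8 * w) = w^-1 / 4 by field; rewrite gt_eqF.
lra.
Qed.

End Entropy.

End Dictionary.
Arguments dot {R J}.
Arguments dotC {R J}.
Arguments nrm_le {R J G}.
Arguments covers_in {R J G}.

(** * Orthogonality of the exponentials *)

Section TorusIntegrals.
Local Open Scope classical_set_scope.
Import numFieldNormedType.Exports.
Context (R : realType).
Local Notation mR := (measurableTypeR R).

Lemma sinDint2pi (a : R) (q : int) : sin (a + q%:~R * (2 * pi)) = sin a.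
Proof.
have periodN (n : nat) (b : R) : sin (b + n%:R * (2 * pi)) = sin b.
  by rewrite [2 * pi]mulr_natl mulr_natl (periodicn (@sinD2pi R)).
case: q => n; first exact: periodN.
rewrite NegzE intrN -[in RHS](subrK (n.+1%:R * (2 * pi)) a) periodN.
by rewrite mulNr.
Qed.

Lemma continuous_cos_affine (b phi : R) :
  continuous (fun x : R => cos (b * x + phi)).
Proof.
move=> x; apply: continuous_comp; last exact: continuous_cos.
by apply: cvgD; [apply: cvgM; [exact: cvg_cst|exact: cvg_id]|exact: cvg_cst].
Qed.

Lemma integral_cos1 (q : int) (phi : R) :
  (\int[lebesgue_measure]_(x in `[0%R, (2 * pi)%R[) (cos (q%:~R * x + phi))%:E =
   ((if q == 0 then 2 * pi * cos phi else 0)%:E : \bar R))%E.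
Proof.
have pi2 : 0 < 2 * pi :> R by rewrite mulr_gt0// pi_gt0.
have [->|q0] := eqVneq q 0.
  under eq_integral do rewrite mul0r add0r.
  rewrite integral_cst//= lebesgue_measure_itv/= lte_fin pi2 -EFinB subr0.
  by rewrite -EFinM mulrC.
have qR : q%:~R != 0 :> R by rewrite intr_eq0.
pose F (x : R) : R := (q%:~R)^-1 * sin (q%:~R * x + phi).
have dF (x : R) : is_derive x 1 F (cos (q%:~R * x + phi)).
  rewrite /F; apply: is_derive_eq.
  by rewrite addr0 /GRing.scale/= mulr1 mulrCA mulVf ?mulr1.
rewrite integral_itv_bndo_bndc; last first.
  apply/measurable_EFinP; apply: measurable_funTS.
  by apply: continuous_measurable_fun; exact: continuous_cos_affine.
rewrite (@continuous_FTC2 _ _ F)//.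
- rewrite -EFinB /F mulr0 add0r (addrC _ phi) sinDint2pi.
  by rewrite subrr.
- by apply: continuous_subspaceT => x; exact: continuous_cos_affine.
- have cF : continuous F.
    by move=> x; apply: differentiable_continuous;
      apply/derivable1_diffP; case: (dF x).
  split.
  + by move=> x _; case: (dF x).
  + by apply: cvg_at_right_filter; exact: cF.
  + by apply: cvg_at_left_filter; exact: cF.
- by move=> x _; rewrite derive1E; case: (dF x).
Qed.

Lemma dotzr_cons (d : nat) (q0 : int) (q : d.-tuple int) (x : R)
    (v : d.-tuple R) :
  dotzr [tuple of q0 :: q] [tuple of x :: v] = q0%:~R * x + dotzr q v.
Proof.
rewrite /dotzr big_ord_recl !tnth0; congr (_ + _).
by apply: eq_bigr => i _; rewrite !tnthS.
Qed.

Lemma tcons_torus (d : nat) : @tcons R d @^-1` torus R d.+1 =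
  `[0%R, (2 * pi)%R[ `*` torus R d.
Proof.
apply/seteqP; split=> -[x v] /=.
  move=> xv; split=> [|i]; first by have := xv ord0; rewrite tnth0 in_itv.
  by have := xv (lift ord0 i); rewrite tnthS.
rewrite in_itv /= => -[x0 vt] i; case: (unliftP ord0 i) => [j|] ->.
  by rewrite tnthS.
by rewrite tnth0.
Qed.

Lemma measurable_torus (d : nat) : measurable (torus R d : set (d.-tuple mR)).
Proof.
have -> : torus R d = \bigcap_(i in [set: 'I_d])
    ((fun x : d.-tuple mR => tnth x i) @^-1` `[0%R, (2 * pi)%R[).
  by apply/seteqP; split=> x /= h i; have := h i; rewrite /= in_itv //; apply.
apply: fin_bigcap_measurable; first exact: finite_finset.
move=> i _; rewrite -[X in measurable X]setTI.
by apply: measurable_tnth.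
Qed.

Lemma lebesgue_torus (d : nat) :
  lebesgue_tuple R d (torus R d) = (((2 * pi) ^+ d)%:E : \bar R).
Proof.
elim: d => [|d IH] /=.
  by rewrite diracE mem_set// => -[].
rewrite /pushforward tcons_torus product_measure1E//=; last first.
  exact: measurable_torus.
rewrite lebesgue_measure_itv/= lte_fin mulr_gt0 ?pi_gt0//.
by rewrite [X in (_ * X)%E]IH -EFinB subr0 exprS.
Qed.

Lemma measurable_dotzr (d : nat) (q : d.-tuple int) :
  measurable_fun [set: d.-tuple mR] (fun x => dotzr q x : mR).
Proof.
apply: measurable_sum => i; apply: measurable_funM => //.
exact: measurable_tnth.
Qed.

Lemma measurable_cos_dotzr (d : nat) (q : d.-tuple int) (phi : R) :
  measurable_fun [set: d.-tuple mR] (fun x => cos (dotzr q x + phi) : mR).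
Proof.
apply: (@measurableT_comp _ _ _ _ _ _ cos).
  by apply: continuous_measurable_fun; exact: continuous_cos.
by apply: measurable_funD => //; exact: measurable_dotzr.
Qed.

Lemma integrable_torus (d : nat) (f : d.-tuple R -> R) (M : R) :
  measurable_fun [set: d.-tuple mR] (f : d.-tuple mR -> mR) ->
  (forall x, `|f x| <= M) ->
  (lebesgue_tuple R d).-integrable (torus R d) (EFin \o f).
Proof.
move=> mf fM; apply: measurable_bounded_integrable.
- exact: measurable_torus.
- by rewrite [ltLHS]lebesgue_torus ltry.
- exact: measurable_funTS.
- exists M; split; first exact: num_real.
  by move=> N MN x _ /=; rewrite (le_trans (fM x))// ltW.
Qed.

Lemma norm_cos_le1 (x : R) : `|cos x| <= 1.
Proof. by rewrite ler_norml cos_geN1 cos_le1. Qed.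

(** Induction on [d] by Fubini. The phase is arbitrary because, once the first coordinate [x] is
    fixed, the remaining integral has phase [q0 * x + phi]. *)
Lemma integral_cos_dotzr (d : nat) (q : d.-tuple int) (phi : R) :
  (\int[lebesgue_tuple R d]_(x in torus R d) (cos (dotzr q x + phi))%:E =
   ((if all (pred1 0) q then (2 * pi) ^+ d * cos phi else 0)%:E : \bar R))%E.
Proof.
elim: d q phi => [|d IH] q phi /=.
  rewrite integral_dirac//; last 2 first.
  - exact: measurable_torus.
  - apply/measurable_EFinP/measurable_funTS; exact: measurable_cos_dotzr.
  rewrite diracE mem_set//; last by case.
  by rewrite (tuple0 q) mul1e /dotzr big_ord0 add0r expr0 mul1r.
case/tupleP: q => q0 q.
pose f (p : R * d.-tuple R) : R := cos (q0%:~R * p.1 + dotzr q p.2 + phi).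
have fE p : cos (dotzr [tuple of q0 :: q] (@tcons R d p) + phi) = f p.
  by case: p => x v; rewrite dotzr_cons.
have mf : measurable_fun [set: mR * d.-tuple mR] (f : mR * d.-tuple mR -> mR).
  have := @measurableT_comp _ _ _ _ _ _ _ _ (@tcons mR d)
    (measurable_cos_dotzr d.+1 [tuple of q0 :: q] phi) (@measurable_tcons R d).
  by apply: eq_measurable_fun => p _; rewrite /= fE.
pose I : set mR := `[0%R, (2 * pi)%R[.
have mI : measurable (I `*` (torus R d : set (d.-tuple mR))).
  by apply: measurableX; [exact: measurable_itv|exact: measurable_torus].
have intf : (lebesgue_measure \x lebesgue_tuple R d)%E.-integrable
    (I `*` torus R d) (EFin \o f).
  apply: measurable_bounded_integrable => //.
  - rewrite -tcons_torus; have := lebesgue_torus d.+1.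
    by rewrite /= /pushforward => ->; rewrite ltry.
  - exact: measurable_funTS.
  - exists 1; split; first exact: num_real.
    by move=> N MN x _ /=; rewrite (le_trans (norm_cos_le1 _))// ltW.
rewrite integral_pushforward//; last 4 first.
- exact: measurable_tcons.
- apply/measurable_EFinP; exact: measurable_cos_dotzr.
- rewrite tcons_torus; apply: eq_integrable intf => // p _ /=.
  by rewrite fE.
- exact: measurable_torus.
rewrite tcons_torus.
transitivity (\int[(lebesgue_measure \x lebesgue_tuple R d)%E]_(p in
    I `*` torus R d)
    (EFin \o f) p)%E.
  by apply: eq_integral => p _ /=; rewrite fE.
(* Fubini is applied on the whole product space, the domain being moved into the integrand as a
   restriction. *)
rewrite integral_mkcond -integral12_prod_meas1; last first.
  exact: (iffLR (integrable_mkcond _ mI) intf).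
rewrite (_ : fubini_F _ _ = (fun x => ((if all (pred1 0) q then (2 * pi) ^+ d *
  cos (q0%:~R * x + phi) else 0)%:E : \bar R)) \_ I); last first.
  apply/funext => x; rewrite /fubini_F patchE; case: ifPn => [xI|xI].
    rewrite -IH [in RHS]integral_mkcond; apply: eq_integral => v _.
    rewrite !patchE in_setX xI /=; case: ifPn => // _.
    by rewrite /f /= addrAC addrA addrAC (addrC (dotzr _ _)) addrAC.
  rewrite integral0_eq// => v _.
  by rewrite patchE in_setX (negbTE xI).
rewrite -integral_mkcond /=.
have [qq|qq] := boolP (all (pred1 0) q); last first.
  by rewrite integral0_eq// andbF.
under eq_integral do rewrite EFinM.
rewrite integralZl//; last 2 first.
- exact: measurable_itv.
- apply: measurable_bounded_integrable.
  + exact: measurable_itv.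
  + by rewrite [X in (X < _)%E]lebesgue_measure_itv/= lte_fin mulr_gt0 ?pi_gt0//
      -EFinB ltry.
  + apply: measurable_funTS; apply: continuous_measurable_fun.
    exact: continuous_cos_affine.
  + exists 1; split; first exact: num_real.
    by move=> N MN x _ /=; rewrite (le_trans (norm_cos_le1 _))// ltW.
rewrite [X in (_ * X)%E](integral_cos1 q0 phi) -EFinM.
by case: eqP => _; rewrite ?mulr0// exprS mulrA (mulrC (_ ^+ d)).
Qed.
End TorusIntegrals.

(** * Trigonometric polynomials *)

Section TrigonometricPolynomials.
Local Open Scope classical_set_scope.
Import numFieldNormedType.Exports.
Context (R : realType) (d : nat) (Q : {fset d.-tuple int}).
Local Notation mR := (measurableTypeR R).
Local Notation J := (Q * bool)%type.
Implicit Types (x y : J -> R) (t : d.-tuple R) (j : J).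

(* Real coordinates of T(Q): the coordinates (k, true) and (k, false) are the
   real and imaginary parts of the k-th coefficient, the latter rotating the
   exponential by pi/2. *)
Definition phase j : R := if j.2 then 0 else pi / 2.

Definition angle j t : R := dotzr (val j.1) t + phase j.

Definition cosv t : J -> R := fun j => cos (angle j t).
Definition sinv t : J -> R := fun j => sin (angle j t).

Definition trigp x t : R[i] := (dot (cosv t) x +i* dot (sinv t) x)%C.

Lemma trigpB x y : trigp x - trigp y = trigp (x - y).
Proof. by apply/funext => t; rewrite fctE /trigp !dotBr. Qed.

Lemma sum_complex (I : Type) (s : seq I) (a b : I -> R) :
  \sum_(i <- s) (a i +i* b i)%C =
  ((\sum_(i <- s) a i) +i* (\sum_(i <- s) b i))%C.
Proof.
elim: s => [|i s IH]; first by rewrite !big_nil.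
by rewrite !big_cons IH.
Qed.

Lemma dot_pair (u x : J -> R) :
  dot u x =
  \sum_(k : Q) (u (k, true) * x (k, true) + u (k, false) * x (k, false)).
Proof.
rewrite /dot (eq_bigr (fun j => u (j.1, j.2) * x (j.1, j.2))); last by case.
rewrite -(pair_bigA _ (fun k b => u (k, b) * x (k, b))) /=.
by apply: eq_bigr => k _; rewrite big_bool.
Qed.

Lemma trigpE x : trigp x = fun t =>
  \sum_(k : Q) (x (k, true) +i* x (k, false))%C * expi (dotzr (val k) t).
Proof.
apply/funext => t; rewrite /trigp !dot_pair -sum_complex.
apply: eq_bigr => k _; rewrite /cosv /sinv /angle /phase /= !addr0.
rewrite cosDpihalf sinDpihalf /expi; simpc; congr (_ +i* _)%C; ring.
Qed.

Lemma trig_polyP f : trig_poly R Q f <-> exists x, f = trigp x.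
Proof.
split=> [[c ->]|[x ->]].
  exists (fun j =>
    if j.2 then complex.Re (c (val j.1)) else complex.Im (c (val j.1))).
  rewrite trigpE; apply/funext => t; rewrite big_seq_fsetE /=.
  by apply: eq_bigr => k _; case: (c _).
exists (fun k =>
  if insub k is Some k' then (x (k', true) +i* x (k', false))%C else 0).
rewrite trigpE; apply/funext => t; rewrite big_seq_fsetE /=.
by apply: eq_bigr => k _; rewrite valK.
Qed.

(** * Euclidean structure of the coordinates and duality *)

Lemma norm_sin_le1 (a : R) : `|sin a| <= 1.
Proof. by rewrite ler_norml sin_geN1 sin_le1. Qed.

Lemma angleB i j t : angle i t - angle j t =
  dotzr [tuple tnth (val i.1) n - tnth (val j.1) n | n < d] t +
    (phase i - phase j).
Proof.
rewrite /angle opprD addrACA; congr (_ + _).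
rewrite /dotzr -sumrB; apply: eq_bigr => n _.
by rewrite tnth_mktuple intrB mulrBl.
Qed.

(** Distinct frequencies integrate to 0; for equal frequencies, the real and imaginary coordinates
    differ in phase by pi/2, where the cosine vanishes. *)
Lemma integral_cos_angleB i j :
  (\int[lebesgue_tuple R d]_(t in torus R d) (cos (angle i t - angle j t))%:E =
   (((i == j)%:R * (2 * pi) ^+ d)%:E : \bar R))%E.
Proof.
under eq_integral do rewrite angleB.
rewrite integral_cos_dotzr; congr (_%:E).
case: i j => [k b] [l c]; rewrite /phase /= xpair_eqE.
have -> : all (pred1 0) [tuple tnth (val k) n - tnth (val l) n | n < d] =
    (k == l).
  apply/allP/eqP => [kl|-> z /mapP[n _ ->] /=]; last by rewrite subrr.
  apply: val_inj; apply: eq_from_tnth => n; apply/eqP; rewrite -subr_eq0.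
  apply: (kl (_ - _)); apply/mapP; exists n => //; exact: mem_enum.
case: eqP => _ /=; last by rewrite mul0r.
case: b c => [] [] /=.
- by rewrite subrr cos0 mulr1 mul1r.
- by rewrite sub0r cosN cos_pihalf mulr0 mul0r.
- by rewrite subr0 cos_pihalf mulr0 mul0r.
- by rewrite subrr cos0 mulr1 mul1r.
Qed.

Lemma measurable_angle j :
  measurable_fun [set: d.-tuple mR] (fun t => angle j t : mR).
Proof. by apply: measurable_funD => //; exact: measurable_dotzr. Qed.

Lemma integrable_cos_angleB i j : (lebesgue_tuple R d).-integrable (torus R d)
  (fun t => (cos (angle i t - angle j t))%:E).
Proof.
apply: (@integrable_torus R d (fun t => cos (angle i t - angle j t)) 1).
  apply: (@measurableT_comp _ _ _ _ _ _ cos).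
    by apply: continuous_measurable_fun; exact: continuous_cos.
  by apply: measurable_funB; exact: measurable_angle.
by move=> t; exact: norm_cos_le1.
Qed.

Lemma measurable_dot_cosv x :
  measurable_fun [set: d.-tuple mR] (fun t => dot (cosv t) x : mR).
Proof.
apply: measurable_sum => j; apply: measurable_funM => //.
apply: (@measurableT_comp _ _ _ _ _ _ cos); last exact: measurable_angle.
by apply: continuous_measurable_fun; exact: continuous_cos.
Qed.

Lemma measurable_dot_sinv x :
  measurable_fun [set: d.-tuple mR] (fun t => dot (sinv t) x : mR).
Proof.
apply: measurable_sum => j; apply: measurable_funM => //.
apply: (@measurableT_comp _ _ _ _ _ _ sin); last exact: measurable_angle.
by apply: continuous_measurable_fun; exact: continuous_sin.
Qed.

Lemma normc_le (a b e : R) : `|a| <= e -> `|b| <= e ->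
  Normc.normc (a +i* b)%C <= 2 * e.
Proof.
move=> ae be; have e0 : 0 <= e := le_trans (normr_ge0 _) ae.
have sqr_le (u : R) : `|u| <= e -> u ^+ 2 <= e ^+ 2.
  by rewrite -(ler_pXn2r (_ : (0 < 2)%N)) ?nnegrE// real_normK ?num_real.
rewrite /Normc.normc -[leRHS]ger0_norm ?mulr_ge0// -sqrtr_sqr.
rewrite ler_wsqrtr//; have := sqr_le _ ae; have := sqr_le _ be.
rewrite exprMn; have := sqr_ge0 e; lra.
Qed.

(** Cauchy-Schwarz in the plane, by Lagrange's identity. *)
Lemma le_normc_mul (a b a' b' : R) :
  a * a' + b * b' <= Normc.normc (a +i* b)%C * Normc.normc (a' +i* b')%C.
Proof.
rewrite /Normc.normc -sqrtrM ?addr_ge0 ?sqr_ge0// (le_trans (ler_norm _))//.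
rewrite -sqrtr_sqr ler_wsqrtr// -subr_ge0.
rewrite (_ : _ - _ = (a * b' - b * a') ^+ 2) ?sqr_ge0//; ring.
Qed.

Lemma normc_ge0 (z : R[i]) : 0 <= Normc.normc z.
Proof. by case: z => a b; rewrite sqrtr_ge0. Qed.

Lemma dot_norm_le x (u : J -> R) : (forall j, `|u j| <= 1) ->
  `|dot u x| <= \sum_j `|x j|.
Proof.
move=> u1; rewrite (le_trans (ler_norm_sum _ _ _))// ler_sum// => j _.
by rewrite normrM ler_piMl.
Qed.

Lemma integrable_normc_trigp x : (lebesgue_tuple R d).-integrable (torus R d)
  (fun t => (Normc.normc (trigp x t))%:E).
Proof.
have ms : measurable_fun [set: d.-tuple mR]
    (fun t => Num.sqrt (dot (cosv t) x ^+ 2 + dot (sinv t) x ^+ 2) : mR).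
  apply: (@measurableT_comp _ _ _ _ _ _ (@Num.sqrt R)).
    by apply: continuous_measurable_fun; exact: sqrt_continuous.
  by apply: measurable_funD; apply: measurable_funX;
    [exact: measurable_dot_cosv|exact: measurable_dot_sinv].
apply: (@integrable_torus R d (fun t => Normc.normc (trigp x t))
  (2 * \sum_j `|x j|)) => //.
move=> t; rewrite ger0_norm ?normc_ge0// normc_le//; apply: dot_norm_le => j.
  exact: norm_cos_le1.
exact: norm_sin_le1.
Qed.

(** The left side is the real part of [trigp x t] times the conjugate of [trigp y t]. *)
Lemma dot_trig t x y :
  dot (cosv t) x * dot (cosv t) y + dot (sinv t) x * dot (sinv t) y =
  \sum_i \sum_j x i * y j * cos (angle i t - angle j t).
Proof.
rewrite /dot !big_distrlr -big_split /=; apply: eq_bigr => i _.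
rewrite -big_split /=; apply: eq_bigr => j _.
by rewrite cosB /cosv /sinv; ring.
Qed.

Lemma integrable_cos_angleB_scaled x y i j :
  (lebesgue_tuple R d).-integrable (torus R d)
  (fun t => (x i * y j * cos (angle i t - angle j t))%:E).
Proof.
apply: (eq_integrable (measurable_torus R d)); last first.
  by apply: (integrableZl (measurable_torus R d) (x i * y j));
    exact: (integrable_cos_angleB i j).
by move=> t _; rewrite EFinM.
Qed.

Lemma integrable_dot_trig x y : (lebesgue_tuple R d).-integrable (torus R d)
  (fun t => (dot (cosv t) x * dot (cosv t) y +
     dot (sinv t) x * dot (sinv t) y)%:E).
Proof.
have mT := measurable_torus R d.
apply: (eq_integrable mT); last first.
  apply: (integrable_sum mT (index_enum J)) => i _.
  by apply: (integrable_sum mT (index_enum J)) => j _;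
      exact: (integrable_cos_angleB_scaled x y i j).
move=> t _; rewrite dot_trig -sumEFin; apply: eq_bigr => i _.
by rewrite sumEFin.
Qed.

Lemma integral_dot_trig x y :
  (\int[lebesgue_tuple R d]_(t in torus R d) (dot (cosv t) x * dot (cosv t) y +
     dot (sinv t) x * dot (sinv t) y)%:E =
   (((2 * pi) ^+ d * dot x y)%:E : \bar R))%E.
Proof.
have mT := measurable_torus R d.
under eq_integral do rewrite dot_trig -sumEFin.
rewrite integral_sum//; last first.
  move=> i; apply: (eq_integrable mT); last first.
    by apply: (integrable_sum mT (index_enum J)) => j _;
      exact: (integrable_cos_angleB_scaled x y i j).
  by move=> t _; rewrite sumEFin.
rewrite (eq_bigr (fun i => (x i * y i * (2 * pi) ^+ d)%:E)); last first.
  move=> i _; under eq_integral do rewrite -sumEFin.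
  rewrite integral_sum//; last by move=> j; exact: integrable_cos_angleB_scaled.
  rewrite (eq_bigr (fun j => (x i * y j * ((i == j)%:R * (2 * pi) ^+ d))%:E)).
    rewrite sumEFin (bigD1 i)//= eqxx mul1r big1 ?addr0// => j ji.
    by rewrite eq_sym (negbTE ji) mul0r mulr0.
  move=> j _; under eq_integral do rewrite EFinM.
  by rewrite integralZl ?integral_cos_angleB//; exact: integrable_cos_angleB.
by rewrite sumEFin -mulr_suml mulrC.
Qed.

(* Duality of the L_1 and L_oo norms: (2 pi)^-d \int Re (f conj g) is the
   Euclidean inner product of the coordinates. *)
Lemma pairing_le x y (B : R) : 0 <= B -> (L1norm (trigp x) <= 1)%E ->
  (forall t, torus R d t -> Normc.normc (trigp y t) <= B) -> dot x y <= B.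
Proof.
move=> B0 x1 yB; have mT := measurable_torus R d.
have p0 : 0 < (2 * pi) ^+ d :> R by rewrite exprn_gt0// mulr_gt0// pi_gt0.
rewrite -(ler_pM2l p0) -lee_fin -integral_dot_trig.
have intx := integrable_normc_trigp x.
apply: (@le_trans _ _ (\int[lebesgue_tuple R d]_(t in torus R d)
    (B%:E * (Normc.normc (trigp x t))%:E))%E).
  apply: le_integral => //.
  - exact: integrable_dot_trig.
  - exact: integrableZl.
  move=> t /set_mem tT; rewrite -EFinM lee_fin.
  rewrite (le_trans (le_normc_mul _ _ _ _))//.
  by rewrite mulrC ler_wpM2r ?normc_ge0//; exact: yB.
rewrite integralZl// mulrC EFinM lee_wpmul2l ?lee_fin//.
by move: x1; rewrite /L1norm lee_pdivrMl// mule1.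
Qed.

Definition L1ball : set (J -> R) := fun x => (L1norm (trigp x) <= 1)%E.

Lemma L1ball0 : L1ball 0.
Proof.
rewrite /L1ball /L1norm integral0_eq ?mule0 ?lee01// => t _.
have dot0 (u : J -> R) : dot u 0 = 0.
  by rewrite /dot big1// => j _; rewrite mulr0.
by rewrite /trigp !dot0 Normc.normc0.
Qed.

(** The duality bound is applied to [x] and to [y] separately, each paired with the difference; no
    triangle inequality for the L_1 norm enters. *)
Lemma L1ball_dot x y (B : R) : L1ball x -> L1ball y -> 0 <= B ->
  (forall t, torus R d t -> Normc.normc (trigp (x - y) t) <= B) ->
  dot (x - y) (x - y) <= 2 * B.
Proof.
move=> xA yA B0 xyB; rewrite dotBl mulr_natl mulr2n lerD//.
  exact: pairing_le.
rewrite -dotNr opprB; apply: pairing_le => // t tT.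
have := xyB t tT; rewrite -!trigpB !fctE -[in X in X -> _](opprB (trigp y t)).
by rewrite normcN.
Qed.

(** Pairing with plus or minus a unit vector, whose polynomial has modulus 1 everywhere. *)
Lemma L1ball_coord x j : L1ball x -> `|x j| <= 1.
Proof.
move=> xA; pose e (s : bool) : J -> R := fun i => (i == j)%:R * (-1) ^+ s.
have dotE s (u : J -> R) : dot u (e s) = (-1) ^+ s * u j.
  rewrite /dot (bigD1 j)//= /e eqxx mul1r mulrC big1 ?addr0// => i ij.
  by rewrite (negbTE ij) mul0r mulr0.
have le1 (s : bool) : (-1) ^+ s * x j <= 1.
  rewrite -dotE; apply: pairing_le => // t _; rewrite /trigp !dotE /Normc.normc.
  rewrite !exprMn sqrr_sign !mul1r /cosv /sinv cos2Dsin2 sqrtr1; exact: lexx.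
by rewrite ler_norml lerNl; have := le1 true; have := le1 false;
  rewrite expr0 expr1 mul1r mulN1r => -> ->.
Qed.

Lemma cos_lipschitz (a b : R) : `|cos a - cos b| <= `|a - b|.
Proof.
wlog ab : a b / a < b.
  move=> H; case: (ltgtP a b) => [/H//|/H|->]; last by rewrite !subrr.
  by rewrite distrC [leRHS]distrC.
have cC : {within `[a, b], continuous (@cos R)}.
  by apply: continuous_subspaceT; exact: continuous_cos.
have [c _ cE] := MVT ab (fun u _ => is_derive_cos u) cC.
rewrite distrC cE -[leRHS]distrC normrM normrN; apply: ler_piMl => //.
exact: norm_sin_le1.
Qed.

Lemma sin_lipschitz (a b : R) : `|sin a - sin b| <= `|a - b|.
Proof.
rewrite -(cosBpihalf a) -(cosBpihalf b) (le_trans (cos_lipschitz _ _))//.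
by rewrite opprB addrA subrK.
Qed.

(** * Discretization of the uniform norm *)

Section Grid.
Context (n M : nat).
Context (M_gt0 : (0 < M)%N).
Context (Q_le : forall q, q \in Q ->
  forall i : 'I_d, `|tnth q i| <= (2 ^ n)%N%:Z).
Context (M_ge : (8 * #|{: J}| * d * 2 ^ n <= M)%N).

Definition node (v : {ffun 'I_d -> 'I_M}) : d.-tuple R :=
  [tuple 2 * pi * (v i)%:R / M%:R | i < d].

(** The entries [inl] evaluate the real and imaginary parts at the nodes. The entries [inr] control
    the coefficients, and thereby the variation between nodes. *)
Definition dictionary (g : {ffun 'I_d -> 'I_M} * bool + J) : J -> R :=
  match g with
  | inl (v, true) => cosv (node v)
  | inl (v, false) => sinv (node v)
  | inr j => fun i => (i == j)%:R
  end.

Lemma dictionary_le1 g j : `|dictionary g j| <= 1.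
Proof.
case: g => [[v []]|i] /=; first exact: norm_cos_le1.
  exact: norm_sin_le1.
by rewrite normr_nat lern1 leq_b1.
Qed.

Lemma dictionary_coord x e : nrm_le dictionary x e -> forall j, `|x j| <= e.
Proof.
move=> xe j; have := xe (inr j).
rewrite /dot (bigD1 j)//= eqxx mul1r big1 ?addr0// => i ij.
by rewrite (negbTE ij) mul0r.
Qed.

Lemma node_near t : torus R d t ->
  exists v, forall i, `|tnth t i - tnth (node v) i| <= 2 * pi / M%:R.
Proof.
move=> tT; have pi0 : 0 < pi :> R := pi_gt0 R.
have p0 : 0 < 2 * pi :> R by rewrite mulr_gt0.
have M0 : 0 < M%:R :> R by rewrite ltr0n.
pose c i := tnth t i * M%:R / (2 * pi).
have c0 i : 0 <= c i.
  by rewrite divr_ge0 ?(ltW p0) ?mulr_ge0//; have /andP[] := tT i.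
have cM i : (Num.trunc (c i) < M)%N.
  rewrite truncn_lt_nat// ltr_pdivrMr// mulrC ltr_pM2l//.
  by have /andP[] := tT i.
exists [ffun i => Ordinal (cM i)] => i; rewrite tnth_mktuple ffunE /=.
have /andP[c1 c2] := truncn_itv (c0 i).
have cE (a T P m : R) : 0 < P -> 0 < m ->
    a - 2 * P * T / m = (a * m / (2 * P) - T) * (2 * P / m).
  by move=> P0 m0; field; rewrite !gt_eqF.
rewrite cE// -/(c i) normrM (ger0_norm (_ : 0 <= 2 * pi / M%:R));
  last by rewrite divr_ge0 ?ltW.
apply: ler_piMl; first by rewrite divr_ge0 ?ltW.
by rewrite ger0_norm ?subr_ge0// lerBlDr addrC natr1 ltW.
Qed.

Lemma angle_lipschitz j t t' (h : R) : 0 <= h ->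
  (forall i, `|tnth t i - tnth t' i| <= h) ->
  `|angle j t - angle j t'| <= d%:R * (2 ^ n)%:R * h.
Proof.
move=> h0 th; rewrite /angle opprD addrACA subrr addr0 /dotzr -sumrB.
rewrite (le_trans (ler_norm_sum _ _ _))// -mulrA mulr_natl.
rewrite -[d in leRHS]card_ord -sumr_const ler_sum// => i _.
rewrite -mulrBr normrM ler_pM//.
by rewrite -intr_norm -[(2 ^ n)%:R]/((2 ^ n)%N%:Z%:~R) ler_int;
  exact: Q_le (valP _) _.
Qed.

Lemma dot_near x (u u' : J -> R) (e h : R) :
  (forall j, `|x j| <= e) -> (forall j, `|u j - u' j| <= h) ->
  `|dot u x| <= `|dot u' x| + #|{: J}|%:R * h * e.
Proof.
move=> xe uh; rewrite -[u in leLHS](subrK u') -lerBlDl.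
have -> : dot (u - u' + u') x = dot (u - u') x + dot u' x.
  by rewrite dotC dotDr !(dotC x).
rewrite lerBlDl (le_trans (ler_normD _ _))// addrC lerD2l.
rewrite (le_trans (ler_norm_sum _ _ _))// -mulrA mulr_natl -sumr_const.
by rewrite ler_sum// => j _; rewrite normrM ler_pM//; exact: uh.
Qed.

(** Moving [t] to a nearby node changes the real and imaginary parts by at most [e], so both are at
    most [2 * e]; [normc_le] gives the second factor 2. *)
Lemma normc_trigp_le x (e : R) t : nrm_le dictionary x e -> torus R d t ->
  Normc.normc (trigp x t) <= 4 * e.
Proof.
move=> xe tT; have [v tv] := node_near _ tT.
have p0 : 0 < pi :> R := pi_gt0 R.
have h0 : 0 <= 2 * pi / M%:R :> R by rewrite divr_ge0// mulr_ge0// ltW.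
have e0 : 0 <= e := le_trans (normr_ge0 _) (xe (inl (v, true))).
have xj := dictionary_coord _ _ xe.
set h := 2 * pi / M%:R in tv h0.
(* This follows from [M_ge] and [2 * pi <= 8]. *)
have mh : #|{: J}|%:R * (d%:R * (2 ^ n)%:R * h) * e <= e.
  apply: ler_piMl => //; rewrite /h !mulrA ler_pdivrMr ?ltr0n// mul1r.
  apply: (@le_trans _ _ (8 * #|{: J}| * d * 2 ^ n)%:R); last by rewrite ler_nat.
  rewrite !natrM; set N := #|_|%:R; set D := d%:R; set p := (2 ^ n)%:R.
  have : (N * D * p) * (2 * pi) <= (N * D * p) * 8.
    apply: ler_wpM2l; first by rewrite !mulr_ge0.
    have /andP[_] := pihalf_02 R; lra.
  lra.
have -> : 4 * e = 2 * (e + e) by ring.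
have ang j := angle_lipschitz j _ _ _ h0 tv.
apply: normc_le.
  apply: (le_trans (dot_near _ _ (cosv (node v)) _ _ xj
    (fun j => le_trans (cos_lipschitz _ _) (ang j)))).
  by rewrite lerD//; exact: (xe (inl (v, true))).
apply: (le_trans (dot_near _ _ (sinv (node v)) _ _ xj
    (fun j => le_trans (sin_lipschitz _ _) (ang j)))).
by rewrite lerD//; exact: (xe (inl (v, false))).
Qed.

Lemma entropy_number_le k (e : R) : covers_in dictionary L1ball (2 ^ k) e ->
  (entropy_number (@sup_norm R d) k (trig_poly_ball R Q) <= (4 * e)%:E)%E.
Proof.
move=> [y [yA Ay]]; apply: ereal_inf_lbound; exists (4 * e) => //.
exists (fun i => trigp (y i)); split=> [i|f [/trig_polyP[x ->] x1]].
  by split; [apply/trig_polyP; exists (y i)|exact: yA].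
have [i xi] := Ay x x1; exists i => //; rewrite /norm_cball /= trigpB.
apply: ge_ereal_sup => _ [t tT <-]; rewrite lee_fin.
exact: normc_trigp_le.
Qed.

Context (Q_neq0 : Q != fset0).

Lemma card_coordinates : #|{: J}| = (2 * #|` Q|)%N.
Proof. by rewrite card_prod card_bool mulnC -cardfE. Qed.

Lemma coordinates_gt0 : (0 < #|{: J}|)%N.
Proof. by rewrite card_coordinates muln_gt0 cardfs_gt0. Qed.

Lemma L1ball_dot_nrm x y (e : R) : L1ball x -> L1ball y ->
  nrm_le dictionary (x - y) e ->
  dot (x - y) (x - y) <= 8 * e.
Proof.
move=> xA yA xye; have -> : 8 * e = 2 * (4 * e) by ring.
apply: L1ball_dot => //; last by move=> t; exact: normc_trigp_le.
(* Any coordinate functional shows that [e] is nonnegative; one exists since [Q] is nonempty. *)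
have := xye (inr (enum_val (Ordinal coordinates_gt0))).
by move=> /(le_trans (normr_ge0 _)) e0; rewrite mulr_ge0.
Qed.

Lemma L1ball_diam x y : L1ball x -> L1ball y ->
  nrm_le dictionary (x - y) (16 * 8 * #|{: J}|%:R).
Proof.
move=> xA yA; rewrite mulrC; apply: nrm_le_max => [|j].
  exact: dictionary_le1.
rewrite !fctE (le_trans (ler_normB _ _))//.
have := L1ball_coord _ j xA; have := L1ball_coord _ j yA; lra.
Qed.

End Grid.

End TrigonometricPolynomials.

(** * Counting frequencies and choice of parameters *)

Lemma card_frequencies (d n : nat) (Q : {fset d.-tuple int}) :
  (forall q, q \in Q -> forall i : 'I_d, `|tnth q i| <= (2 ^ n)%N%:Z) ->
  (#|` Q| <= 2 ^ ((n + 2) * d))%N.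
Proof.
move=> Q_le.
pose K := (2 ^ (n + 2)).-1.
have KE : K.+1 = (2 ^ (n + 2))%N by rewrite prednK// expn_gt0.
have K2 : (2 * 2 ^ n <= K)%N.
  by rewrite -ltnS KE addn2 !expnS; have := expn_gt0 2 n; lia.
(* Shifted by [2 ^ n], the entries lie between 0 and [2 ^ n.+1], hence fit into [n + 2] bits. *)
pose f (q : Q) : {ffun 'I_d -> 'I_K.+1} :=
  [ffun i => inord (absz (tnth (val q) i + (2 ^ n)%N%:Z)%R)].
have f_inj : injective f.
  have shift_le (p : nat) (a : int) : `|a| <= p%:Z ->
      (absz (a + p%:Z)%R <= 2 * p)%N.
    by lia.
  have shift_inj (p : nat) (a b : int) : `|a| <= p%:Z -> `|b| <= p%:Z ->
    absz (a + p%:Z)%R = absz (b + p%:Z)%R -> a = b by lia.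
  move=> q r /ffunP fqr; apply: val_inj; apply: eq_from_tnth => i.
  have qi := Q_le _ (valP q) i; have ri := Q_le _ (valP r) i.
  have := fqr i; rewrite !ffunE => /(congr1 val) /=.
  rewrite !inordK ?ltnS ?(leq_trans (shift_le _ _ _) K2)//.
  exact: shift_inj.
rewrite cardfE (leq_trans (leq_card _ f_inj))//.
by rewrite card_ffun !card_ord KE expnM.
Qed.

Theorem theorem2p6 (R : realType) (d : nat) (hd : (0 < d)%N) :
  exists C : R, 0 < C /\
    forall (n : nat) (Q : {fset d.-tuple int}) (k : nat),
      (0 < n)%N ->
      Q != fset0 ->
      (forall q : d.-tuple int, q \in Q ->
         forall i : 'I_d, `|tnth q i| <= (2 ^ n)%N%:Z) ->
      (0 < k)%N ->
      ((k <= 2 * #|` Q |)%N ->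
         (entropy_number (@sup_norm R d) k (trig_poly_ball R Q) <=
          (C * (n%:R `^ (3 / 2) * (#|` Q |%:R / k%:R)))%:E)%E) /\
      ((2 * #|` Q | <= k)%N ->
         (entropy_number (@sup_norm R d) k (trig_poly_ball R Q) <=
          (C * (n%:R `^ (3 / 2) *
                2 `^ (- (k%:R / (2 * #|` Q |%:R)))))%:E)%E).
Proof.
pose c := (3 + (4 * d + 5) * d)%N.
have c0 : 0 < c%:R :> R by rewrite ltr0n.
(* The factor [2 ^+ 14] is [4 * 512 * 8]: the passage to the uniform norm, the constant of
   [covers_large], and [kappa = 8]. *)
exists (2 ^+ 14 * c%:R); split=> [|n Q k n0 Q0 Q_le k0].
  by rewrite mulr_gt0// exprn_gt0.
have cardQ := card_frequencies _ _ _ Q_le.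
(* Taking [M = 2 ^ mu], the summands account for the factors [16], [#|Q|], [d] and [2 ^ n] of
   [M_ge]. *)
pose mu := (4 + (n + 2) * d + d + n)%N.
pose L := (3 + mu * d)%N.
have LE : L%:R <= c%:R * n%:R :> R.
  rewrite -natrM ler_nat /L /c.
  have dn : (d <= n * d)%N by rewrite leq_pmull.
  have mun : (mu <= (4 * d + 5) * n)%N by rewrite /mu; lia.
  have : (mu * d <= (4 * d + 5) * n * d)%N by rewrite leq_mul2r mun orbT.
  by move: (mu * d)%N => e; lia.
have M0 : (0 < 2 ^ mu)%N by rewrite expn_gt0.
have J0 := coordinates_gt0 d Q Q0.
have JE := card_coordinates d Q.
have M_ge : (8 * #|{: Q * bool}| * d * 2 ^ n <= 2 ^ mu)%N.
  rewrite JE /mu !(expnD 2 _ n) (expnD 2 _ d) (expnD 2 4).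
  apply: leq_mul => //; apply: leq_mul; last exact: ltnW (ltn_expl _ _).
  by rewrite mulnA; apply: leq_mul.
pose dict := dictionary R d Q (2 ^ mu).
(* The dictionary has [2 * M ^ d + #|J|] entries, and [#|J| <= M <= M ^ d] since [d] is positive;
   hence the left side is at most [7 * M ^ d]. *)
have G_le : ((2 * #|{: {ffun 'I_d -> 'I_(2 ^ mu)} * bool + (Q * bool)}|).+1 <=
    2 ^ L)%N.
  rewrite card_sum (card_prod {ffun _ -> _}) card_ffun !card_ord card_bool.
  rewrite /L expnD (expnM 2 mu d).
  have : (2 ^ mu <= (2 ^ mu) ^ d)%N by rewrite -{1}(expn1 (2 ^ mu)) leq_pexp2l.
  have : (#|{: Q * bool}| <= 2 ^ mu)%N.
    apply: leq_trans M_ge; rewrite -!mulnA mulnCA leq_pmulr//.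
    by rewrite !muln_gt0 hd expn_gt0.
  rewrite -[(2 ^ 3)%N]/8%N.
  move: (2 ^ mu)%N ((2 ^ mu) ^ d)%N #|_| M0 => M' P N; lia.
have A0 : (L1ball R d Q !=set0)%classic by exists 0; exact: L1ball0.
have A_dot x y t := L1ball_dot_nrm R d Q n (2 ^ mu) M0 Q_le M_ge Q0 x y t.
have A_diam := L1ball_diam R d Q (2 ^ mu).
have k8 : 0 < 8 :> R by [].
have L0 : (0 < L)%N by [].
have coord := dictionary_coord R d Q (2 ^ mu).
have n1 : n%:R <= n%:R `^ (3 / 2) :> R.
  rewrite -{1}[n%:R]powRr1 ?ler0n// ler_powR ?ler1n//; lra.
have Ln : L%:R <= c%:R * n%:R `^ (3 / 2) :> R.
  by rewrite (le_trans LE)// ler_wpM2l.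
have ent e := entropy_number_le R d Q n (2 ^ mu) M0 Q_le M_ge k e.
split=> [kQ|kQ].
  apply: (le_trans (ent _ (covers_small _ _ _ dict (dictionary_le1 _ _ _ _) J0
    _ _ _ k8 A0 A_dot A_diam L0 G_le k k0))).
  rewrite lee_fin JE natrM.
  have -> : 4 * (32 * 8 * L%:R * (2 * #|` Q|%:R / k%:R)) =
    2 ^+ 11 * (L%:R * (#|` Q|%:R / k%:R)) :> R by ring.
  rewrite -mulrA ler_pM ?mulr_ge0 ?divr_ge0 ?exprn_ge0//.
    by rewrite ler_weXn2l ?ler1n.
  by rewrite [leRHS]mulrA ler_wpM2r ?divr_ge0.
apply: (le_trans (ent _ (covers_large _ _ _ dict (dictionary_le1 _ _ _ _) J0
  coord _ _ _ k8 A0 A_dot A_diam L0 G_le k _))); first by rewrite JE.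
rewrite lee_fin JE natrM.
have -> : 4 * (512 * 8 * L%:R * 2 `^ (- (k%:R / (2 * #|` Q|%:R)))) =
    2 ^+ 14 * (L%:R * 2 `^ (- (k%:R / (2 * #|` Q|%:R)))) :> R by ring.
rewrite -mulrA ler_pM2l ?exprn_gt0//.
by rewrite [leRHS]mulrA ler_wpM2r ?powR_ge0.
Qed.
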